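(* Let $n\ge 2$ and $G\cong Sp_{2n}(2)$, with $D$ its set of symplectic transvections. Then $\varphi(G)=2n+2$.
   Context: $Sp_{2n}(2)$ is the isometry group of the $2n$-dimensional nondegenerate symplectic space $V$ over $\mathbb F_2$, and $D$ is the set of transvections $t(v):w\mapsto w+(w,v)v$ with $0\neq v\in V$. $\varphi(G)$ denotes the maximal integer $m$ for which there is an injective homomorphism $S_m\to G$ sending every transposition $(i\,j)$ into $D$. *)

(* Defs.v *)
From HB Require Import structures.
From mathcomp Require Import all_boot all_order all_algebra all_fingroup all_field.

Set Implicit Arguments.
Unset Strict Implicit.
Unset Printing Implicit Defensive.

Import GRing.Theory.
Local Open Scope ring_scope.
Local Open Scope group_scope.

(* Linear isometries are taken inside the permutations of the finite set of
   vectors; [finvect_type V] is [V] equipped with its finite type structure. *)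
Definition Sp_set (V : vectType 'F_2) (f : {skew_symmetric V}) :
    {set {perm finvect_type V}} :=
  [set g : {perm finvect_type V} |
    [forall a : 'F_2, forall u, forall v, g (a *: u + v)%R == (a *: g u + g v)%R]
    && [forall u, forall v, f (g u) (g v) == f u v]].

Lemma Sp_group_set (V : vectType 'F_2) (f : {skew_symmetric V}) :
  group_set (Sp_set f).
Proof.
apply/group_setP; split=> [|g h].
  rewrite inE; apply/andP; split.
    by apply/forallP=> a; apply/forallP=> u; apply/forallP=> v; rewrite !perm1.
  by apply/forallP=> u; apply/forallP=> v; rewrite !perm1.
rewrite !inE => /andP[/forallP linG /forallP isoG] /andP[/forallP linH /forallP isoH].
apply/andP; split.
  apply/forallP=> a; apply/forallP=> u; apply/forallP=> v; rewrite !permM.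
  have /forallP/(_ u)/forallP/(_ v)/eqP-> := linG a.
  by have /forallP/(_ (g u))/forallP/(_ (g v)) := linH a.
apply/forallP=> u; apply/forallP=> v; rewrite !permM.
have /forallP/(_ (g v))/eqP-> := isoH (g u).
by have /forallP/(_ v) := isoG u.
Qed.

Definition Sp (V : vectType 'F_2) (f : {skew_symmetric V}) :
    {group {perm finvect_type V}} := Group (Sp_group_set f).

Definition transvection (V : vectType 'F_2) (f : {skew_symmetric V})
    (v w : finvect_type V) : finvect_type V := (w + f w v *: v)%R.

Definition transvections (V : vectType 'F_2) (f : {skew_symmetric V}) :
    {set {perm finvect_type V}} :=
  [set g : {perm finvect_type V} |
    [exists v, (v != 0%R) && [forall w, g w == transvection f v w]]].

(* When [f] is alternating every transvection is an isometry, so the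
   restriction to permutations in [transvections] loses nothing. *)
Lemma transvection_in (V : vectType 'F_2) (f : {skew_symmetric V})
    (v : finvect_type V) :
    is_psymplectic f -> v != 0%R ->
  exists2 g, g \in transvections f :&: Sp f & g =1 transvection f v.
Proof.
case=> _ _ /(_ (pchar_Fp (isT : prime 2))) alt v_neq0.
have tK : involutive (transvection f v).
  move=> w; rewrite /transvection linearDl linearZl_LR /= [f v v]alt mulr0 addr0.
  by rewrite -addrA -scalerDl addrr_pchar2 ?pchar_Fp // scale0r addr0.
exists (perm (can_inj tK)) => [|w]; last by rewrite permE.
rewrite inE; apply/andP; split; rewrite inE.
  apply/existsP; exists v; rewrite v_neq0; apply/forallP=> w.
  by rewrite permE.
apply/andP; split.
  apply/forallP=> a; apply/forallP=> u; apply/forallP=> w; apply/eqP.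
  rewrite !permE /transvection linearDl linearZl_LR /=.
  by rewrite scalerDl scalerDr scalerA addrACA.
apply/forallP=> u; apply/forallP=> w; apply/eqP; rewrite !permE /transvection.
rewrite linearDl !linearDr /= !linearZl_LR !linearZr_LR /= [f v v]alt.
rewrite !mulr0 addr0 -addrA [f v w]hermC expr1 mulN1r /= mulrN mulrC.
by rewrite addrN addr0.
Qed.

Definition sym_embeds (gT : finGroupType) (G : {group gT}) (D : {set gT})
    (m : nat) : Prop :=
  exists h : {morphism [set: 'S_m] >-> gT},
    [/\ 'injm h, h @* [set: 'S_m] \subset G
      & forall i j : 'I_m, i != j -> h (tperm i j) \in D].

(* [is_phi G D m] reads: phi(G) is defined and equal to m. *)
Definition is_phi (gT : finGroupType) (G : {group gT}) (D : {set gT})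
    (m : nat) : Prop :=
  sym_embeds G D m /\ forall k, sym_embeds G D k -> (k <= m)%N.

(* Main.v *)
Require Import Defs.
From mathcomp Require Import all_boot all_order all_algebra all_fingroup all_field.

(* Two transvections t(u), t(v) commute when (u, v) = 0.  So in an embedding of
   S_(m+1) the vectors of the transpositions (0 i), for m values of i, have Gram
   matrix J - I, which has rank at least m - 1; hence m - 1 <= 2n.
   Conversely, repeatedly adding the sum of the vectors found so far to the two
   members of a hyperbolic pair orthogonal to them gives a maximal family with
   Gram matrix J - I, and this yields vectors p_0, ..., p_(2n+1) such that
   (p_i + p_j, p_k + p_l) counts the coincidences between {i, j} and {k, l}.
   The transvection at p_i + p_j then permutes the vectors p_k + p_l through the
   transposition (i j), and an isometry and the permutation of the indices that
   it induces determine each other, so the relation between them is the graph of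
   an embedding of S_(2n+2). *)

Set Implicit Arguments.
Unset Strict Implicit.
Unset Printing Implicit Defensive.

(** * Rank of Gram matrices and dimension counts for orthogonality *)

Section LinearAlgebra.

Import GRing.Theory.
Local Open Scope ring_scope.

Variables (F : fieldType) (V : vectType F) (eps : bool) (theta : {rmorphism F -> F}).
Variable f : {hermitian V for eps & theta}.

Lemma herm_coord (v w : V) :
  f v w = \sum_(l < \dim {:V}) coord (vbasis {:V}) l v * f (vbasis {:V})`_l w.
Proof.
rewrite {1}(coord_vbasis (memvf v)) linear_sumlz /=.
by apply: eq_bigr => l _; rewrite linearZl_LR.
Qed.

(** Coordinates in a basis factor the Gram matrix through a space of dimension [\dim {:V}]. *)
Lemma mxrank_gram m (a : 'I_m -> V) :
  (\rank (\matrix_(i, j) f (a i) (a j))%R <= \dim {:V})%N.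
Proof.
pose A := \matrix_(i < m, l < \dim {:V}) coord (vbasis {:V}) l (a i).
pose B := \matrix_(l < \dim {:V}, j < m) f (vbasis {:V})`_l (a j).
suff -> : \matrix_(i, j) f (a i) (a j) = A *m B.
  exact: leq_trans (mxrankM_maxl _ _) (rank_leq_col _).
by apply/matrixP=> i j; rewrite !mxE herm_coord; apply: eq_bigr => l _; rewrite !mxE.
Qed.

(** Coordinate rows of such a [z] form the left kernel of a matrix with more rows than columns. *)
Lemma orthogonal_neq0 m (a : 'I_m -> V) : (m < \dim {:V})%N ->
  exists2 z : V, z != 0 & forall i, f z (a i) = 0.
Proof.
move=> ltmV; pose B := \matrix_(l < \dim {:V}, j < m) f (vbasis {:V})`_l (a j).
have : kermx B != 0.
  rewrite kermx_eq0; apply: contraL ltmV => /eqP <-.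
  by rewrite -leqNgt rank_leq_col.
case/rowV0Pn=> c /sub_kermxP cB0 c0.
exists (\sum_l c 0 l *: (vbasis {:V})`_l).
  apply: contra c0 => /eqP z0; apply/eqP/rowP=> l.
  rewrite mxE -(coord_sum_free (c 0) l (basis_free (vbasisP {:V}))).
  by rewrite z0 linear0.
move=> i; rewrite linear_sumlz /=.
have := congr1 (fun M : 'rV_m => M 0 i) cB0; rewrite !mxE; apply: etrans.
by apply: eq_bigr => l _; rewrite linearZl_LR /= !mxE.
Qed.

End LinearAlgebra.

(** * Families with Gram matrix J - I in a symplectic space over F_2 *)

Section Simplex.

Import GRing.Theory.
Local Open Scope ring_scope.

Lemma F2_neq0 (x : 'F_2) : x != 0 -> x = 1.
Proof. by case: x => [[|[|k]] lt2] // _; apply/val_inj. Qed.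

Lemma F2_natr (b : nat) : b%:R = (odd b)%:R :> 'F_2.
Proof.
by rewrite -[b in LHS]odd_double_half natrD -mul2n natrM pchar_Zp // mul0r addr0.
Qed.

Variables (V : vectType 'F_2) (f : {skew_symmetric V}).
Hypothesis fS : is_psymplectic f.

Lemma symp_alt u : f u u = 0.
Proof. by have [_ _] := fS; apply; apply: pchar_Fp. Qed.

Lemma symp_sym u v : f u v = f v u.
Proof. by rewrite hermC expr1 /= mulN1r oppr_pchar2 ?pchar_Fp. Qed.

Lemma addvv (u : V) : u + u = 0.
Proof. by rewrite -[u]scale1r -scalerDl addrr_pchar2 ?pchar_Fp // scale0r. Qed.

Lemma symp_ex z : z != 0 -> exists y, f y z = 1.
Proof.
move=> z0; have [/eqP nd _ _] := fS.
have : z \notin orthov f fullv by rewrite nd memv0.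
by case/mem_orthovPn => y _ fzy; exists y; rewrite symp_sym; apply: F2_neq0.
Qed.

Lemma simplex_dim m (a : 'I_m -> V) :
    (forall i j, f (a i) (a j) = (i != j)%:R) -> (m <= (\dim {:V}).+1)%N.
Proof.
move=> aP; pose G := \matrix_(i, j) f (a i) (a j).
(* [1 = J - G] over F_2, where the all-ones matrix [J] has rank at most 1. *)
have GE : 1%:M = (const_mx 1 : 'cV_m) *m const_mx 1 - G :> 'M['F_2]_m.
  apply/matrixP=> i j; rewrite !mxE big_ord1 !mxE mulr1 aP.
  by case: eqP; rewrite ?subr0 ?subrr.
rewrite -[m in (m <= _)%N](mxrank1 'F_2) GE.
apply: leq_trans (mxrank_add _ _) _; rewrite mxrank_opp.
apply: (@leq_add _ _ 1); last exact: mxrank_gram.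
exact: leq_trans (mxrankM_maxl _ _) (rank_leq_col _).
Qed.

(** Indexing by [nat] lets a family grow without casts between ordinal types. *)
Definition simplex m (a : nat -> V) :=
  forall i j, (i < m)%N -> (j < m)%N -> f (a i) (a j) = (i != j)%:R.

(** The vector [a j] pairs to 1 with the 2k - 1 others, an odd number, and to 0 with itself. *)
Lemma simplex_sum k a j : simplex k.*2 a -> (j < k.*2)%N ->
  f (\sum_(i < k.*2) a i) (a j) = 1.
Proof.
move=> aP ltj; rewrite linear_sumlz (bigD1 (Ordinal ltj)) //= symp_alt add0r.
rewrite (eq_bigr (fun _ => 1)) => [|i ne]; last first.
  by rewrite aP // -[j]/(val (Ordinal ltj)) val_eqE ne.
rewrite sumr_const cardC1 card_ord F2_natr.
by case: k ltj {aP} => //= k; rewrite odd_double.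
Qed.

(** In even size over F_2 the matrix J - I is its own inverse. Hence the projection along the span
    of the [a i] has coefficients [f y (a i + s)], the sum of the [f y (a l)] over l distinct from
    i. *)
Lemma simplex_extend k a z : simplex k.*2 a -> z != 0 ->
    (forall i, (i < k.*2)%N -> f z (a i) = 0) ->
  exists a', simplex k.*2.+2 a'.
Proof.
move=> aP z0 za; have [y yz] := symp_ex z0.
pose s := \sum_(i < k.*2) a i.
have sa j : (j < k.*2)%N -> f s (a j) = 1 by apply: simplex_sum.
have sz : f s z = 0.
  by rewrite linear_sumlz big1 //= => i _; rewrite symp_sym za.
(* [y'] is the projection of [y] to the orthogonal of the [a i]. *)
pose y' := y + \sum_(i < k.*2) f y (a i + s) *: a i.
have y'z : f y' z = 1.
  rewrite linearDl /= yz linear_sumlz big1 ?addr0 // => i _.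
  by rewrite linearZl_LR /= [f _ z]symp_sym za ?mulr0.
have y'a j : (j < k.*2)%N -> f y' (a j) = 0.
  move=> ltj; rewrite linearDl linear_sumlz /=.
  rewrite (eq_bigr (fun i : 'I__ =>
      f y (a i + s) - f y (a i + s) * (i == j :> nat)%:R)); last first.
    move=> i _; rewrite linearZl_LR /= aP //.
    by case: eqP; rewrite ?mulr1 ?mulr0 ?subr0 ?subrr.
  rewrite sumrB (bigD1 (Ordinal ltj) _ (F := fun i => _ * _)) //= eqxx mulr1.
  rewrite [in X in _ - X]big1 ?addr0 => [|i ne]; last first.
    by rewrite -[j]/(val (Ordinal ltj)) val_eqE (negPf ne) mulr0.
  rewrite -linear_sumr big_split /= -/s sumr_const card_ord -muln2 mulrnA.
  rewrite mulr2n addvv addr0.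
  by rewrite linearDr /= addrA subrr.
have s_y' : f s y' = 0.
  by rewrite linear_sumlz big1 //= => i _; rewrite symp_sym y'a.
clearbody y'.
exists (fun i => if (i < k.*2)%N then a i else if i == k.*2 then s + z else s + y').
have elim_lt i : (i < k.*2.+2)%N -> [\/ (i < k.*2)%N, i = k.*2 | i = k.*2.+1].
  rewrite ltnS leq_eqVlt ltnS leq_eqVlt => /orP[/eqP->|/orP[/eqP->|]].
  - by constructor 3.
  - by constructor 2.
  - by constructor 1.
have szy' : f (s + z) (s + y') = 1.
  rewrite linearDl !linearDr /= symp_alt s_y' [f z s]symp_sym sz [f z y']symp_sym y'z.
  by rewrite !add0r.
have lt1 : (k.*2.+1 < k.*2)%N = false by rewrite ltnNge leqnSn.
have eq1 : (k.*2.+1 == k.*2) = false by rewrite gtn_eqF.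
move=> i j /elim_lt[lti|->|->] /elim_lt[ltj|->|->];
  rewrite ?lti ?ltj ?lt1 ?eq1 ?ltnn ?eqxx /=.
- exact: aP.
- by rewrite symp_sym linearDl /= sa // za // addr0 ltn_eqF.
- by rewrite symp_sym linearDl /= sa // y'a // addr0 ltn_eqF // ltnS ltnW.
- by rewrite linearDl /= sa // za // addr0 gtn_eqF.
- by rewrite symp_alt.
- by rewrite szy' eq_sym eq1.
- by rewrite linearDl /= sa // y'a // addr0 gtn_eqF // ltnS ltnW.
- by rewrite symp_sym szy'.
- by rewrite symp_alt.
Qed.

Lemma ex_simplex n : \dim {:V} = (2 * n)%N ->
  exists2 a, simplex n.*2.+1 a &
    forall w, (forall i, (i < n.*2)%N -> f w (a i) = 0) -> w = 0.
Proof.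
rewrite mul2n => dimV.
have [a aP] : exists a, simplex n.*2 a.
  have : (n <= n)%N by []; elim: {-2}n => [|k IHk] ltkn; first by exists (fun=> 0).
  have [a aP] := IHk (ltnW ltkn).
  have [|z z0 za] := @orthogonal_neq0 _ _ _ _ f _ (fun i : 'I_k.*2 => a i).
    by rewrite dimV ltn_double.
  by apply: simplex_extend aP z0 _ => i lti; apply: (za (Ordinal lti)).
have a_tot w : (forall i, (i < n.*2)%N -> f w (a i) = 0) -> w = 0.
  move=> wa; apply/eqP/negPn/negP=> w0.
  have [b bP] := simplex_extend aP w0 wa.
  (* Otherwise [a] would extend to a simplex larger than the dimension allows. *)
  have := @simplex_dim n.*2.+2 (fun i => b i); rewrite dimV ltnn => contra.
  by apply: notF; apply: contra => i j; apply: bP.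
(* The last vector comes for free: by [simplex_sum], the sum of the first 2n pairs to 1 with each of
   them. *)
exists (fun i => if (i < n.*2)%N then a i else \sum_(j < n.*2) a j); last first.
  by move=> w wa; apply: a_tot => i lti; have := wa i lti; rewrite lti.
move=> i j; rewrite ltnS [(i <= _)%N]leq_eqVlt ltnS [(j <= _)%N]leq_eqVlt.
move=> /orP[/eqP->|lti] /orP[/eqP->|ltj]; rewrite ?lti ?ltj ?ltnn ?eqxx.
- exact: symp_alt.
- by rewrite simplex_sum // gtn_eqF.
- by rewrite symp_sym simplex_sum // ltn_eqF.
- exact: aP.
Qed.

(* The vector [p i + p j] is the class of the set [{i, j}] when [V] is identified
   with the even subsets of ['I_(2 * n + 2)] modulo complementation. *)
Lemma ex_even_weight_model n : \dim {:V} = (2 * n)%N ->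
  exists p : 'I_(2 * n + 2) -> V,
    (forall i j k l, f (p i + p j) (p k + p l) =
       (i == k)%:R + (i == l)%:R + (j == k)%:R + (j == l)%:R) /\
    (forall w, (forall i j, f w (p i + p j) = 0) -> w = 0).
Proof.
move=> dimV; have [a aP a_tot] := ex_simplex dimV.
(* The class of the even set [{0, i}] is [p i]; in particular [p 0 = 0]. *)
pose p (i : 'I_(2 * n + 2)) := if i == 0%N :> nat then 0 else a i.-1.
(* On expanding [f (p i + p j) (p k + p l)], each term that depends on a single index occurs twice
   and the constant 1 four times, so only the coincidences survive. *)
have pE i j : f (p i) (p j) =
    (i == j)%:R + ((i == 0%N :> nat)%:R + (j == 0%N :> nat)%:R + 1).
  rewrite /p -val_eqE /=; case: i j => [[|i] lti] [[|j] ltj] /=.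
  - by rewrite symp_alt; apply/val_inj.
  - by rewrite linear0l; apply/val_inj.
  - by rewrite linear0r; apply/val_inj.
  - rewrite aP; first 1 last.
    + by move: lti; rewrite mul2n addn2 ltnS.
    + by move: ltj; rewrite mul2n addn2 ltnS.
    + by rewrite eqSS !add0r; case: eqP => _; apply/val_inj.
exists p; split=> [i j k l|w wp].
  rewrite linearDl !linearDr /= !pE.
  by case: (i == k); case: (i == l); case: (j == k); case: (j == l);
    case: (i == 0%N :> nat); case: (j == 0%N :> nat); case: (k == 0%N :> nat);
    case: (l == 0%N :> nat); apply/val_inj.
apply: a_tot => i lti.
have lt0 : (0 < 2 * n + 2)%N by rewrite addn2.
have ltS : (i.+1 < 2 * n + 2)%N by rewrite mul2n addn2 !ltnS ltnW.
by have := wp (Ordinal lt0) (Ordinal ltS); rewrite /p /= add0r.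
Qed.

End Simplex.

(** * The action of the symmetric group by isometries *)

Section Embedding.

Import GRing.Theory.
Local Open Scope group_scope.

Variables (V : vectType 'F_2) (f : {skew_symmetric V}%R).
Hypothesis fS : is_psymplectic f.
Local Notation T := (finvect_type V).

Lemma Sp_isom (g : {perm T}) (u v : V) : g \in Sp f -> f (g u) (g v) = f u v.
Proof. by rewrite inE => /andP[_ /forallP/(_ u)/forallP/(_ v)/eqP]. Qed.

Lemma transvection_commute (u v : V) (s t : {perm T}) :
  s =1 transvection f u -> t =1 transvection f v -> f u v = 0%R -> commute s t.
Proof.
move=> su tv uv0; apply/permP=> w; rewrite !permM !(su, tv) /transvection.
rewrite !linearDl !linearZl_LR /= [f v u]symp_sym // uv0.
by rewrite !mulr0 !addr0 addrAC.
Qed.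

Variables (N : nat) (p : 'I_N -> V).
Hypothesis N_ge5 : 5 <= N.
Hypothesis pE : forall i j k l, f (p i + p j)%R (p k + p l)%R =
  ((i == k)%:R + (i == l)%:R + (j == k)%:R + (j == l)%:R)%R.
Hypothesis p_tot : forall w, (forall i j, f w (p i + p j)%R = 0%R) -> w = 0%R.

Lemma ord_fresh (s : seq 'I_N) : size s < N -> exists i, i \notin s.
Proof.
move=> lts; apply/existsP; rewrite -negb_forall; apply: contraL lts => /forallP sP.
rewrite -leqNgt -[N in N <= _]size_enum_ord; apply: uniq_leq_size (enum_uniq _) _.
by move=> i _; apply: sP.
Qed.

(** For a third index k, [p i + p k] pairs to 1 with [p i + p j]. *)
Lemma edge_neq0 i j : i != j -> (p i + p j)%R != 0%R.
Proof.
move=> neij; have [|k] := @ord_fresh [:: i; j]; first exact: leq_trans N_ge5.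
rewrite !inE negb_or ![k == _]eq_sym => /andP[neik nejk].
apply/eqP=> pij0; have := pE i j i k.
rewrite pij0 linear0l eqxx (negPf neik) (negPf nejk) eq_sym (negPf neij).
by move/(congr1 val).
Qed.

(** Only the sums are permuted: in the model built above one [p i] is zero, so no isometry can move
    it to another. *)
Definition acts_as (g : {perm T}) (s : 'S_N) :=
  g \in Sp f /\ forall i j, g (p i + p j)%R = (p (s i) + p (s j))%R.

(** Pairing [g w] with [p k + p l] amounts to pairing [w] with the preimage of [p k + p l], which
    depends on [s] alone; then [p_tot] applies to [g w - h w]. *)
Lemma acts_as_uniq g h s : acts_as g s -> acts_as h s -> g = h.
Proof.
move=> [gS gE] [hS hE]; apply/permP=> w; apply/eqP; rewrite -subr_eq0.
apply/eqP/p_tot=> k l; rewrite linearBl /=.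
have pkl (x : {perm T}) : (forall i j, x (p i + p j)%R = (p (s i) + p (s j))%R) ->
    (p k + p l)%R = x (p ((s^-1)%g k) + p ((s^-1)%g l))%R.
  by move=> ->; rewrite !permKV.
by rewrite {1}(pkl g gE) (pkl h hE) !Sp_isom // subrr.
Qed.

(** If [s i] and [t i] differ, take j with [t j] distinct from [s i], and l outside the four images
    of i and j. Then {s i, l} meets {s i, s j} in one point and misses {t i, t j}, although both
    pairs give [g (p i + p j)]. Avoiding four points is what requires 5 indices. *)
Lemma acts_as_inj g s t : acts_as g s -> acts_as g t -> s = t.
Proof.
move=> [_ gs] [_ gt]; apply/permP=> i; apply/eqP/negPn/negP=> ne.
have [|j] := @ord_fresh [:: i; (s^-1 (t i)); (t^-1 (s i))].
  exact: leq_trans N_ge5.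
rewrite !inE !negb_or => /and3P[ji jst jts].
have [|l] := @ord_fresh [:: s i; s j; t i; t j]; first exact: N_ge5.
rewrite !inE !negb_or => /and4P[lsi lsj lti ltj].
have := pE (s i) (s j) (s i) l; rewrite -gs gt pE.
rewrite ![_ == l]eq_sym (negPf lsi) (negPf lsj) (negPf lti) (negPf ltj) eqxx.
rewrite (inj_eq perm_inj) (negPf ji) [t i == _]eq_sym (negPf ne).
rewrite -(inj_eq (@perm_inj _ t^-1)) permK (negPf jts).
by move/(congr1 val).
Qed.

Lemma acts_as1 : acts_as 1 1.
Proof. by split=> [|i j]; rewrite ?group1 // !perm1. Qed.

Lemma acts_asM g h s t : acts_as g s -> acts_as h t -> acts_as (g * h) (s * t).
Proof.
move=> [gS gE] [hS hE]; split=> [|i j]; first exact: groupM.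
by rewrite !permM gE hE.
Qed.

Lemma acts_as_tperm g i j :
  i != j -> g \in Sp f -> g =1 transvection f (p i + p j)%R -> acts_as g (tperm i j).
Proof.
move=> neij gS gE; split=> // k l; rewrite gE /transvection pE.
(* Swapping i and j adds [p i + p j] exactly at these two indices; summed over k and l, the
   coefficients give that of the transvection. *)
have tE m : p (tperm i j m) = (p m + ((m == i)%:R + (m == j)%:R) *: (p i + p j))%R.
  case: tpermP => [->|->|/eqP/negPf-> /eqP/negPf->].
  - by rewrite eqxx (negPf neij) addr0 scale1r addrA addvv // add0r.
  - by rewrite eqxx eq_sym (negPf neij) add0r scale1r addrCA addvv // addr0.
  - by rewrite addr0 scale0r addr0.
by rewrite !tE addrACA -scalerDl !addrA.
Qed.

Lemma ex_acts_as s : exists g, acts_as g s.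
Proof.
have [ts -> /allP ts_neq] := prod_tpermP s.
elim: ts ts_neq => [|[i j] ts IHts] ts_neq.
  by exists 1; rewrite big_nil; apply: acts_as1.
have [|h hP] := IHts; first by move=> t tin; apply: ts_neq; rewrite inE tin orbT.
have neij : i != j by apply: (ts_neq (i, j)); rewrite mem_head.
have [g /setIP[_ gS] gE] := transvection_in fS (edge_neq0 neij).
by exists (g * h); rewrite big_cons; apply: acts_asM hP; apply: acts_as_tperm.
Qed.

(** An arbitrary choice of isometries is multiplicative, because [acts_as] is closed under products
    and determines the isometry. *)
Lemma ex_sym_action : exists h : 'S_N -> {perm T},
  [/\ forall s, acts_as (h s) s, {morph h : s t / s * t}
    & forall i j, i != j -> h (tperm i j) \in transvections f].
Proof.
have [h hP] := fin_all_exists ex_acts_as; exists h; split=> // [s t|i j neij].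
  by apply: acts_as_uniq (hP _) _; apply: acts_asM.
have [g /setIP[gD gS] gE] := transvection_in fS (edge_neq0 neij).
by rewrite (acts_as_uniq (hP _) (acts_as_tperm neij gS gE)).
Qed.

End Embedding.

(** * Transport along [iota], and the lower and upper bounds *)

Section Bounds.

Local Open Scope group_scope.

Variables (V : vectType 'F_2) (f : {skew_symmetric V}%R).
Variables (gT : finGroupType) (G : {group gT}) (iota : {morphism Sp f >-> gT}).
Hypotheses (fS : is_psymplectic f) (iota_isom : isom (Sp f) G iota).

Lemma sym_embeds_Sp n : 2 <= n -> \dim {:V} = (2 * n)%N ->
  sym_embeds G (iota @* transvections f) (2 * n + 2).
Proof.
move=> n_ge2 dimV; have [p [pE p_tot]] := ex_even_weight_model fS dimV.
have N_ge5 : 5 <= 2 * n + 2.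
  by rewrite addn2 2!ltnS; apply: leq_trans (leq_mul (leqnn 2) n_ge2).
have [h [hP hM hD]] := ex_sym_action fS N_ge5 pE p_tot.
have hS s : h s \in Sp f by have [] := hP s.
have /isomP[/injmP iota_inj iotaG] := iota_isom.
have ihM : {in [set: 'S_(2 * n + 2)] &, {morph iota \o h : s t / s * t}}.
  by move=> s t _ _; rewrite /= hM morphM ?hS.
exists (Morphism ihM); split.
- apply/injmP=> s t _ _ /= /(iota_inj _ _ (hS s) (hS t)) eq_h.
  apply: (acts_as_inj N_ge5 pE (hP s)).
  by rewrite eq_h.
- by apply/subsetP=> _ /morphimP[s _ _ ->]; rewrite -iotaG;
  apply: mem_morphim; apply: hS.
- by move=> i j /hD tD; apply: mem_morphim tD; apply: hS.
Qed.

Lemma sym_embeds_le k :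
  sym_embeds G (iota @* transvections f) k -> k <= (\dim {:V}).+2.
Proof.
(* From here the degree is [k.+1], and the transpositions moving [ord0] give k vectors. *)
case: k => // k [h [/injmP h_inj _ hD]].
have pick_vector (i : 'I_k) : exists v : V, exists t : {perm finvect_type V},
    [/\ t \in Sp f, t =1 transvection f v & h (tperm ord0 (lift ord0 i)) = iota t].
  have /morphimP[t tS] := hD ord0 (lift ord0 i) isT.
  rewrite inE => /existsP[v /andP[_ /forallP tv]] ht.
  by exists v, t; split=> // w; apply/eqP.
have [v vP] := fin_all_exists pick_vector.
rewrite ltnS; apply: (simplex_dim (f := f) (a := v)) => i j.
case: eqVneq => [->|neij]; first exact: symp_alt.
apply: F2_neq0; apply/eqP=> vij0.
have [s [sS sv hs]] := vP i; have [t [tS tv ht]] := vP j.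
have : tperm ord0 (lift ord0 i) * tperm ord0 (lift ord0 j)
     = tperm ord0 (lift ord0 j) * tperm ord0 (lift ord0 i).
  apply: h_inj; rewrite ?inE // !morphM ?inE // hs ht -!morphM //.
  by rewrite (transvection_commute sv tv vij0).
(* The two products send [ord0] to [lift ord0 i] and [lift ord0 j] respectively. *)
move/permP/(_ ord0); rewrite !permM !tpermL.
rewrite !tpermD ?(inj_eq lift_inj) // 1?eq_sym // => /lift_inj ij.
by rewrite ij eqxx in neij.
Qed.

End Bounds.

Theorem proposition2 (n : nat) (V : vectType 'F_2) (f : {skew_symmetric V}%R)
    (gT : finGroupType) (G : {group gT}) (iota : {morphism Sp f >-> gT}) :
  2 <= n ->
  \dim {:V} = 2 * n ->
  is_psymplectic f ->
  isom (Sp f) G iota ->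
  is_phi G (iota @* transvections f)%g (2 * n + 2).
Proof.
move=> n_ge2 dimV fS iota_isom; split; first exact: sym_embeds_Sp.
by move=> k /(sym_embeds_le fS); rewrite dimV addn2.
Qed.
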